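(* Fix integers $k\ge1$ and $\ell\ge1$. For integers $N\ge0$, $m\ge1$ and $0\le r\le k-1$, define recursively \[ E_{k\ell}(0,m;r) := \delta_{0,r} \left\{{m \atop \ell}\right\}\frac{1}{(m-1)!}, \] \[ E_{k\ell}(N,m;r) := \sum_{a=0}^{m-\ell} N^a \sum_{j=0}^{k-1} E_{k\ell}\bigl(N-1,m-a;(r- N j) \bmod k \bigr) \frac{k^{a-1} }{a!} B_a(j/k) \qquad (N \ge 1). \] Then for every $N\ge1$ with $k\le N$, every $0\le h<k$ with $\gcd(h,k)=1$, and every $1\le\ell\le\lfloor N/k\rfloor$, writing $\rho=e^{2\pi i h/k}$, \[ C_{hk\ell}(N) = \frac{(-1)^N (\ell-1)!}{ N!} \sum_{r=0}^{k-1} \rho^{r+\ell} E_{k\ell}(N,N;r). \]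
   Context: For an integer $N\ge1$, Rademacher's coefficients $C_{hk\ell}(N)\in\mathbb{C}$ are defined by the (unique) partial fraction decomposition $\prod_{j=1}^N \frac{1}{1-q^j}=\sum_{0\le h<k\le N,\ \gcd(h,k)=1}\ \sum_{\ell=1}^{\lfloor N/k\rfloor} \frac{C_{hk\ell}(N)}{(q-e^{2\pi i h/k})^\ell}$. $\left\{{m \atop \ell}\right\}$ is the Stirling number of the second kind, $\delta$ is the Kronecker delta, and $B_a(t)$ is the Bernoulli polynomial defined by $\frac{ze^{tz}}{e^z-1}=\sum_{n\ge0}B_n(t)\frac{z^n}{n!}$. An empty sum (e.g. when $m<\ell$) is $0$. *)

(* Defs.v *)
From HB Require Import structures.
From mathcomp Require Import all_boot all_order all_algebra.
From mathcomp Require Import complex.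
From mathcomp Require Import reals trigo.

Set Implicit Arguments.
Unset Strict Implicit.
Unset Printing Implicit Defensive.

Import Order.TTheory GRing.Theory Num.Theory.
Local Open Scope ring_scope.

Definition stirling2 (m l : nat) : nat :=
  #|[set P : {set {set 'I_m}} | partition P [set: 'I_m] & #|P| == l]|.

(* A formal power series is represented by its sequence of coefficients. *)
Section FormalPowerSeries.
Variable F : fieldType.
Implicit Types f g : nat -> F.

Definition fps_mul f g (n : nat) : F := \sum_(i < n.+1) f i * g (n - i)%N.

Fixpoint fps_div_seq f g (n : nat) : seq F :=
  if n is n'.+1 then
    let s := fps_div_seq f g n' in
    rcons s ((f n' - \sum_(i < n') s`_i * g (n' - i)%N) / g 0%N)
  else [::].

(* The quotient f / g, meaningful when g has a nonzero constant term: see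
   fps_divK. *)
Definition fps_div f g (n : nat) : F := (fps_div_seq f g n.+1)`_n.

Lemma size_fps_div_seq f g n : size (fps_div_seq f g n) = n.
Proof. by elim: n => //= n IHn; rewrite size_rcons IHn. Qed.

Lemma nth_fps_div_seq f g n i :
  (i < n)%N -> (fps_div_seq f g n)`_i = fps_div f g i.
Proof.
elim: n => // n IHn; rewrite ltnS leq_eqVlt => /predU1P[-> //|lt_in].
by rewrite /= nth_rcons size_fps_div_seq lt_in IHn.
Qed.

Lemma fps_divK f g : g 0%N != 0 -> fps_mul (fps_div f g) g =1 f.
Proof.
move=> g0 n; rewrite /fps_mul big_ord_recr /= subnn.
rewrite [X in _ + X * _]/fps_div /= nth_rcons size_fps_div_seq ltnn eqxx.
rewrite divfK //.
under [X in _ + (_ - X)]eq_bigr => i _ do rewrite nth_fps_div_seq //.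
by rewrite addrC subrK.
Qed.

End FormalPowerSeries.

(* B_n(t) / n! is the coefficient of z^n in e^(tz) / ((e^z - 1) / z). *)
Definition bernoulli (F : numFieldType) (n : nat) (t : F) : F :=
  n`!%:R * fps_div (fun i => t ^+ i / i`!%:R) (fun i => (i.+1)`!%:R^-1) n.

(* (sum_n B_n(t) z^n / n!) (e^z - 1) = z e^(tz) *)
Lemma bernoulli_gen (F : numFieldType) (t : F) (n : nat) :
  fps_mul (fun i => bernoulli i t / i`!%:R)
          (fun i => (i != 0%N)%:R / i`!%:R) n
  = if n is p.+1 then t ^+ p / p`!%:R else 0.
Proof.
have factn0 k : k`!%:R != 0 :> F by rewrite pnatr_eq0 -lt0n fact_gt0.
case: n => [|n]; first by rewrite /fps_mul big_ord1 /= mul0r mulr0.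
rewrite /fps_mul big_ord_recr /= subnn eqxx mul0r mulr0 addr0.
rewrite -(@fps_divK F (fun i => t ^+ i / i`!%:R) (fun i => (i.+1)`!%:R^-1)) //.
  apply: eq_bigr => i _; rewrite /bernoulli (mulrC i`!%:R) mulfK //.
  by rewrite subSn ?mul1r // -ltnS.
by rewrite invr_eq0 factn0.
Qed.

(* The residue r is an integer so that r - N j needs no truncation. *)
Fixpoint Ecoef (F : numFieldType) (k l N m : nat) (r : int) : F :=
  if N is N'.+1 then
    \sum_(0 <= a < m.+1 - l) N%:R ^+ a *
      \sum_(0 <= j < k)
        Ecoef F k l N' (m - a) ((r - (N * j)%N%:Z) %% k%:Z)%Z *
        (k%:R ^ (a%:Z - 1) / a`!%:R) * bernoulli a (j%:R / k%:R)
  else (r == 0)%:R * (stirling2 m l)%:R * ((m.-1)`!%:R)^-1.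

Definition expi (R : realType) (x : R) : R[i] := Complex (cos x) (sin x).

(* e^(2 pi i h / k) *)
Definition zeta (R : realType) (h k : nat) : R[i] :=
  expi (2 * pi * h%:R / k%:R).

(* The partial fraction decomposition defining Rademacher's coefficients
   C h k l = C_{hkl}(N): an equality of rational functions of q, stated at every
   q that is not a pole. *)
Definition rademacher_coefs (R : realType) (N : nat)
    (C : nat -> nat -> nat -> R[i]) : Prop :=
  forall q : R[i],
    (forall j : nat, (1 <= j <= N)%N -> q ^+ j != 1) ->
    \prod_(1 <= j < N.+1) (1 - q ^+ j)^-1 =
    \sum_(1 <= k < N.+1) \sum_(0 <= h < k | coprime h k)
      \sum_(1 <= l < (N %/ k).+1) C h k l / (q - zeta R h k) ^+ l.

(* Main.v *)
Require Import Defs.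
From HB Require Import structures.
From mathcomp Require Import all_boot all_order all_algebra.
From mathcomp Require Import complex ring lra zify.
From mathcomp Require Import boolp reals trigo.

(* C_{hkl}(N) is the residue at q = rho of (q - rho)^(l-1) prod_j 1/(1 - q^j).
   Substituting q = rho e^z turns it into rho^l times the coefficient of z^(-1)
   in e^z (e^z - 1)^(l-1) prod_j 1/(1 - rho^j e^(jz)).  Up to the factor
   (l-1)!, the first part is the derivative of (e^z - 1)^l / l!, the exponential
   generating function of the Stirling numbers.  Since rho^(jk) = 1,
     1/(1 - rho^j e^(jz)) = sum_(i < k) rho^(ji) e^(ijz) / (1 - e^(jkz)),
   which the Bernoulli polynomials expand as - factor_series j / (j z), and the
   recursion for E_{kl}(N, m; r) multiplies these expansions together.
   Once the decomposition is cleared to a polynomial identity, the substitution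
   is one of formal power series, and the only residues needed are those of
   e^z / (e^z - 1)^t. *)

Set Implicit Arguments.
Unset Strict Implicit.
Unset Printing Implicit Defensive.

Import Order.TTheory GRing.Theory Num.Theory.
Local Open Scope ring_scope.

(** * The ring of formal power series *)

Record fpseries (F : Type) := FPS { fps_coef :> nat -> F }.

(** Coefficient sequences have no decidable equality; the equality and choice that the ring
    structures require are classical. *)
HB.instance Definition _ (F : Type) := gen_eqMixin (fpseries F).
HB.instance Definition _ (F : Type) := gen_choiceMixin (fpseries F).

Lemma fpsP (F : Type) (f g : fpseries F) : f =1 g -> f = g.
Proof. by case: f g => [f] [g] /= /funext ->. Qed.

Section SeriesRing.
Variable F : fieldType.
Implicit Types f g h : fpseries F.

Let add f g := FPS (fun n => f n + g n).
Let opp f := FPS (fun n => - f n).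
Let mul f g := FPS (fps_mul f g).

Fact fps_addA : associative add.
Proof. by move=> f g h; apply: fpsP => n /=; rewrite addrA. Qed.
Fact fps_addC : commutative add.
Proof. by move=> f g; apply: fpsP => n /=; rewrite addrC. Qed.
Fact fps_add0 : left_id (FPS (fun=> 0)) add.
Proof. by move=> f; apply: fpsP => n /=; rewrite add0r. Qed.
Fact fps_addN : left_inverse (FPS (fun=> 0)) opp add.
Proof. by move=> f; apply: fpsP => n /=; rewrite addNr. Qed.

HB.instance Definition _ := GRing.isZmodule.Build (fpseries F)
  fps_addA fps_addC fps_add0 fps_addN.

(** Up to degree [n], products of series are products of truncations, so associativity,
    commutativity and the Leibniz rule come from [{poly F}]. *)
Definition fps_trunc n f : {poly F} := \poly_(i < n.+1) f i.

Lemma coef_fps_trunc n f i : (i <= n)%N -> (fps_trunc n f)`_i = f i.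
Proof. by move=> le_in; rewrite coef_poly ltnS le_in. Qed.

Lemma coef_trunc_mul n f g i : (i <= n)%N ->
  (fps_trunc n f * fps_trunc n g)`_i = fps_mul f g i.
Proof.
move=> le_in; rewrite coefM; apply: eq_bigr => j _.
have le_jn : (j <= n)%N by apply: leq_trans le_in; rewrite -ltnS.
by rewrite !coef_fps_trunc // (leq_trans (leq_subr _ _)).
Qed.

Fact fps_mulC : commutative mul.
Proof.
move=> f g; apply: fpsP => n /=.
by rewrite -(coef_trunc_mul f g (leqnn n)) mulrC coef_trunc_mul.
Qed.

Fact fps_mulA : associative mul.
Proof.
move=> f g h; apply: fpsP => n /=.
have truncE : (fps_trunc n f * fps_trunc n g * fps_trunc n h)`_n =
              fps_mul f (mul g h) n.
  rewrite -mulrA coefM /fps_mul; apply: eq_bigr => i _.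
  by rewrite (coef_fps_trunc f (leq_ord i)) (coef_trunc_mul g h (leq_subr i n)).
rewrite -truncE coefM [RHS]/fps_mul; apply: eq_bigr => i _.
rewrite (coef_trunc_mul f g (leq_ord i)).
by rewrite (coef_fps_trunc h (leq_subr i n)).
Qed.

Fact fps_mul1 : left_id (FPS (fun n => (n == 0%N)%:R)) mul.
Proof.
move=> f; apply: fpsP => n /=; rewrite /fps_mul big_ord_recl /= mul1r subn0.
by rewrite big1 ?addr0 // => i _; rewrite mul0r.
Qed.
Fact fps_mulDl : left_distributive mul add.
Proof.
move=> f g h; apply: fpsP => n /=; rewrite /fps_mul -big_split /=.
by apply: eq_bigr => i _; rewrite mulrDl.
Qed.
Fact fps_1neq0 : FPS (fun n => (n == 0%N)%:R : F) != 0.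
Proof.
apply/eqP => /(congr1 (fun f : fpseries F => f 0%N)) /= /eqP.
by rewrite oner_eq0.
Qed.

HB.instance Definition _ := GRing.Zmodule_isComNzRing.Build (fpseries F)
  fps_mulA fps_mulC fps_mul1 fps_mulDl fps_1neq0.

Lemma fcoef1 n : (1 : fpseries F) n = (n == 0%N)%:R. Proof. by []. Qed.
Lemma fcoefD f g n : (f + g) n = f n + g n. Proof. by []. Qed.
Lemma fcoefB f g n : (f - g) n = f n - g n. Proof. by []. Qed.
Lemma fcoefM f g n : (f * g) n = \sum_(i < n.+1) f i * g (n - i)%N.
Proof. by []. Qed.
Lemma fcoefM0 f g : (f * g) 0%N = f 0%N * g 0%N.
Proof. by rewrite fcoefM big_ord1. Qed.
Lemma fcoef_sum I (r : seq I) (P : pred I) (f : I -> fpseries F) n :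
  (\sum_(i <- r | P i) f i) n = \sum_(i <- r | P i) f i n.
Proof. exact: (big_morph (fun g : fpseries F => g n)). Qed.

Lemma fcoefM_trunc n f g i : (i <= n)%N ->
  (f * g) i = (fps_trunc n f * fps_trunc n g)`_i.
Proof. by move=> le_in; rewrite coef_trunc_mul. Qed.

Definition fpsC (a : F) : fpseries F :=
  FPS (fun n => if n is 0%N then a else 0).

Lemma fcoefCM a f n : (fpsC a * f) n = a * f n.
Proof.
by rewrite fcoefM big_ord_recl /= subn0 big1 ?addr0 // => i _; rewrite mul0r.
Qed.

Fact fpsC_zmod_morphism : zmod_morphism fpsC.
Proof. by move=> a b; apply: fpsP => -[|n] //; rewrite fcoefB /= subr0. Qed.
HB.instance Definition _ :=
  GRing.isZmodMorphism.Build F (fpseries F) fpsC fpsC_zmod_morphism.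
Fact fpsC_monoid_morphism : monoid_morphism fpsC.
Proof.
split=> [|a b]; apply: fpsP => -[|n]; rewrite ?fcoefCM //=.
by rewrite mulr0.
Qed.
HB.instance Definition _ :=
  GRing.isMonoidMorphism.Build F (fpseries F) fpsC fpsC_monoid_morphism.

Definition fpsX : fpseries F := FPS (fun n => (n == 1%N)%:R).

Lemma fcoefXM f n : (fpsX * f) n = if n is n'.+1 then f n' else 0.
Proof.
rewrite fcoefM big_ord_recl /= mul0r add0r.
case: n => [|n]; first by rewrite big_ord0.
rewrite big_ord_recl /= mul1r subSS subn0 big1 ?addr0 // => i _.
by rewrite mul0r.
Qed.

Lemma fcoefXnM m f n :
  (fpsX ^+ m * f) n = if (m <= n)%N then f (n - m)%N else 0.
Proof.
elim: m n => [|m IHm] n; first by rewrite mul1r subn0.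
by rewrite exprS -mulrA fcoefXM; case: n => [|n] //; rewrite IHm.
Qed.

(** [fpseries F] is given no integral domain structure, so cancellation is proved for the factors
    that occur: powers of [fpsX] here, then series with nonzero constant term. *)
Lemma fpsXI : injective ( *%R fpsX).
Proof.
move=> f g eq_fg; apply: fpsP => n.
have {}eq_fg : fpsX * f = fpsX * g by [].
by rewrite -[f n](fcoefXM f n.+1) eq_fg fcoefXM.
Qed.

Lemma fpsXnI m : injective ( *%R (fpsX ^+ m)).
Proof.
elim: m => [|m IHm] f g; first by rewrite !mul1r.
by rewrite !exprS -!mulrA => /fpsXI/IHm.
Qed.

Lemma fps_inv f : f 0%N != 0 -> exists g, f * g = 1.
Proof.
move=> f0; exists (FPS (fps_div (1 : fpseries F) f)).
by apply: fpsP => n; rewrite mulrC; apply: fps_divK.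
Qed.

Lemma fps_unitI f : f 0%N != 0 -> injective ( *%R f).
Proof.
case/fps_inv=> g fg g1 g2 /(congr1 ( *%R g)).
by rewrite !mulrA (mulrC g) fg !mul1r.
Qed.

(** The substitution of a z for z. *)
Definition fps_scale a f : fpseries F := FPS (fun n => a ^+ n * f n).

Lemma fcoef_scale a f n : fps_scale a f n = a ^+ n * f n. Proof. by []. Qed.

Lemma fps_scaleM a f g : fps_scale a (f * g) = fps_scale a f * fps_scale a g.
Proof.
apply: fpsP => n; rewrite fcoef_scale !fcoefM mulr_sumr.
apply: eq_bigr => i _; rewrite !fcoef_scale.
by rewrite -{1}(@subnKC i n) -1?ltnS // exprD mulrACA.
Qed.

Definition fps_deriv f : fpseries F := FPS (fun n => f n.+1 *+ n.+1).

Lemma fcoef_deriv f n : fps_deriv f n = f n.+1 *+ n.+1. Proof. by []. Qed.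

Lemma fps_derivM f g :
  fps_deriv (f * g) = fps_deriv f * g + f * fps_deriv g.
Proof.
apply: fpsP => n; rewrite fcoefD fcoef_deriv (fcoefM_trunc f g (leqnn _)).
rewrite -coef_deriv derivM coefD !coefM !fcoefM.
by congr (_ + _); apply: eq_bigr => i _;
  rewrite coef_deriv !coef_fps_trunc // ?ltnS ?leq_subr ?(leq_ord i) //;
  rewrite (leq_trans _ (leqnSn n)) ?leq_subr ?leq_ord.
Qed.

Lemma fps_deriv1 : fps_deriv 1 = 0.
Proof. by apply: fpsP => n /=; rewrite mul0rn. Qed.

Lemma fps_derivX f n :
  fps_deriv (f ^+ n.+1) = (f ^+ n * fps_deriv f) *+ n.+1.
Proof.
elim: n => [|n IHn]; first by rewrite expr1 mul1r.
by rewrite exprS fps_derivM IHn mulrnAr mulrA -exprS mulrC -mulrS.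
Qed.

End SeriesRing.

Arguments fpsX {F}.

(** * Functions with a prescribed kernel, and Stirling numbers *)

Section FunctionsByKernel.
Variables (T S : finType) (P : {set {set T}}).
Hypothesis partP : partition P [set: T].

Let block := {B : {set T} | B \in P}.

Fact pblock_in x : pblock P x \in P.
Proof. by rewrite pblock_mem // (cover_partition partP) inE. Qed.

Let blk x : block := exist _ (pblock P x) (pblock_in x).

Fact blkE x y : (blk x == blk y) = (y \in pblock P x).
Proof.
have [_ trivP _] := and3P partP.
by rewrite -val_eqE /= eq_pblock // (cover_partition partP) inE.
Qed.

Fact blk_onto (B : block) : exists x, blk x == B.
Proof.
have [_ trivP P0] := and3P partP; case: B => B PB.
have [B0|[x Bx]] := set_0Vmem B; first by rewrite -B0 PB in P0.
by exists x; rewrite -val_eqE /= (def_pblock trivP PB Bx).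
Qed.

Let rep B := xchoose (blk_onto B).

Fact repK : cancel rep blk.
Proof. by move=> B; apply/eqP/(xchooseP (blk_onto B)). Qed.

Fact preim_partition_pblock (f : {ffun T -> S}) :
  (preim_partition f [set: T] == P) =
  [forall x, forall y, (f x == f y) == (y \in pblock P x)].
Proof.
apply/eqP/'forall_forallP => [<- x y|kerf].
  rewrite pblock_equivalence_partition ?inE //.
  by apply: in3W => u v w; split=> // /eqP->.
rewrite -[RHS](equivalence_partition_pblock partP).
apply: eq_imset => x; apply/setP=> y; rewrite !inE /=.
by rewrite (eqP (kerf x y)).
Qed.

(** A function whose fibres are the blocks of [P] is an injection of the blocks into [S], composed
    with the map sending a point to its block. *)
Lemma card_preim_partition :
  #|[set f : {ffun T -> S} | preim_partition f [set: T] == P]| = #|S| ^_ #|P|.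
Proof.
have <- : #|[set g : {ffun block -> S} | injectiveb g]| = #|S| ^_ #|P|.
  by rewrite card_inj_ffuns card_sig.
pose phi (g : {ffun block -> S}) := [ffun x => g (blk x)].
have phi_inj : injective phi.
  move=> g1 g2 /ffunP eq_phi; apply/ffunP=> B.
  by have := eq_phi (rep B); rewrite !ffunE repK.
rewrite -(card_imset _ phi_inj); apply/eq_card => f.
rewrite inE preim_partition_pblock.
apply/'forall_forallP/imsetP => [kerf|[g]].
  exists [ffun B => f (rep B)].
    rewrite inE; apply/injectiveP => B1 B2; rewrite !ffunE => /eqP.
    by rewrite (eqP (kerf _ _)) -blkE !repK => /eqP.
  apply/ffunP=> x; rewrite !ffunE; apply/eqP.
  by rewrite (eqP (kerf _ _)) -blkE repK.
rewrite inE => /injectiveP g_inj -> x y.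
by rewrite !ffunE (inj_eq g_inj) blkE.
Qed.

End FunctionsByKernel.

(** Functions from an m-set to an l-set are sorted by their kernel: a partition into j blocks is the
    kernel of [l ^_ j] of them. *)
Lemma stirling2_expn l m :
  (l ^ m = \sum_(j < l.+1) stirling2 m j * l ^_ j)%N.
Proof.
rewrite -[X in (X ^ _)%N]card_ord -[X in (_ ^ X)%N]card_ord -card_ffun -sum1_card.
rewrite (partition_big
  (fun f : {ffun 'I_m -> 'I_l} => preim_partition f [set: 'I_m])
  (fun P => partition P [set: 'I_m])) /=; last first.
  by move=> f _; apply: preim_partitionP.
under eq_bigr => P partP do rewrite sum1dep_card card_preim_partition // card_ord.
transitivity (\sum_(P | partition P [set: 'I_m])
                \sum_(j < l.+1 | #|P| == j) l ^_ j)%N.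
  apply: eq_bigr => P _; have [le_Pl|lt_lP] := leqP #|P| l.
    by rewrite (big_pred1 (Ordinal (le_Pl : #|P| < l.+1)%N)) // => j;
       rewrite eq_sym.
  (* Partitions with more than [l] blocks fall outside the range of j, but their falling factorial
     vanishes. *)
  rewrite ffact_small // big1 // => j /eqP eqP.
  by move: (ltn_ord j); rewrite -eqP ltnNge lt_lP.
rewrite (exchange_big_dep xpredT) //=; apply: eq_bigr => j _.
by rewrite sum_nat_const /stirling2 cardsE.
Qed.

(** * Exponential series and generating functions of the Stirling numbers *)

Section ExponentialSeries.
Variable F : numFieldType.
Implicit Types (a b : F).

Lemma natr_fact_neq0 n : n`!%:R != 0 :> F.
Proof. by rewrite pnatr_eq0 -lt0n fact_gt0. Qed.

Definition fps_exp a : fpseries F := FPS (fun n => a ^+ n / n`!%:R).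

Lemma fcoef_exp a n : fps_exp a n = a ^+ n / n`!%:R. Proof. by []. Qed.

Lemma fps_expD a b : fps_exp (a + b) = fps_exp a * fps_exp b.
Proof.
apply: fpsP => n; rewrite fcoefM fcoef_exp addrC exprDn mulr_suml.
apply: eq_bigr => i _; rewrite !fcoef_exp -mulr_natr.
rewrite -(bin_fact (leq_ord i)) !natrM.
have C_neq0 : 'C(n, i)%:R != 0 :> F by rewrite pnatr_eq0 -lt0n bin_gt0 leq_ord.
by field; rewrite !natr_fact_neq0.
Qed.

Lemma fps_exp0 : fps_exp 0 = 1.
Proof.
by apply: fpsP => -[|n]; rewrite fcoef_exp fcoef1 ?divr1 // expr0n mul0r.
Qed.

Lemma fps_expMn a n : fps_exp (a *+ n) = fps_exp a ^+ n.
Proof.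
by elim: n => [|n IHn]; rewrite ?fps_exp0 // mulrS fps_expD IHn exprS.
Qed.

Lemma fps_deriv_exp1 : fps_deriv (fps_exp 1 - 1) = fps_exp 1.
Proof.
apply: fpsP => n; rewrite fcoef_deriv fcoefB fcoef1 subr0 !fcoef_exp !expr1n.
rewrite factS natrM -mulr_natr; field.
by rewrite natr_fact_neq0 addrC natr1 pnatr_eq0.
Qed.

(** Both families have the same binomial transform, e^(nz) = (1 + (e^z - 1))^n, by [stirling2_expn];
    that transform is triangular with unit diagonal, so induction on [l] identifies them. *)
Lemma stirling2_egf l :
  FPS (fun m => (stirling2 m l * l`!)%:R / m`!%:R) = (fps_exp 1 - 1) ^+ l.
Proof.
pose A j : fpseries F := FPS (fun m => (stirling2 m j * j`!)%:R / m`!%:R).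
have expE n : \sum_(j < n.+1) A j *+ 'C(n, j) =
              \sum_(j < n.+1) (fps_exp 1 - 1) ^+ j *+ 'C(n, j).
  transitivity (fps_exp 1 ^+ n).
    rewrite -fps_expMn; apply: fpsP => m.
    rewrite fcoef_exp -natrX stirling2_expn natr_sum mulr_suml fcoef_sum.
    apply: eq_bigr => j _; rewrite -[A j *+ _]mulr_natl -(rmorph_nat (@fpsC F)).
    rewrite fcoefCM /= -bin_ffact !natrM.
    ring.
  rewrite -{1}[fps_exp 1](subrK 1) addrC exprDn.
  by apply: eq_bigr => j _; rewrite expr1n mul1r.
elim/ltn_ind: l => l IHl; have := expE l; rewrite !big_ord_recr /= binn.
rewrite (eq_bigr (fun j : 'I_l => (fps_exp 1 - 1) ^+ j *+ 'C(l, j))); last first.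
  by move=> j _; rewrite -IHl.
by move/addrI.
Qed.

(** The derivative of [stirling2_egf] at [l.+1], divided by [l.+1]. The shift in m matches the
    (m-1)! in the base case of [Ecoef]. *)
Lemma stirling2_succ_egf l :
  FPS (fun m => (stirling2 m.+1 l.+1 * l`!)%:R / m`!%:R) =
  fps_exp 1 * (fps_exp 1 - 1) ^+ l.
Proof.
have lS_neq0 n : n.+1%:R != 0 :> F by rewrite pnatr_eq0.
have := congr1 (@fps_deriv F) (stirling2_egf l.+1).
rewrite fps_derivX fps_deriv_exp1 => eq_deriv.
apply: fpsP => m; apply: (mulfI (lS_neq0 l)).
transitivity (fps_deriv (FPS (fun m =>
  (stirling2 m l.+1 * l.+1`!)%:R / m`!%:R) : fpseries F) m).
  rewrite fcoef_deriv /= !factS -mulr_natr !natrM.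
  by field; rewrite natr_fact_neq0 addrC natr1 lS_neq0.
rewrite eq_deriv -[_ *+ _]mulr_natl -(rmorph_nat (@fpsC F)) fcoefCM.
by rewrite [fps_exp 1 * _]mulrC.
Qed.

End ExponentialSeries.

(** * Bernoulli expansions and the recursion for [Ecoef] *)

Section BernoulliSeries.
Variable F : numFieldType.
Implicit Types (c t rho : F).

Lemma fps_expB1 c :
  fps_exp c - 1 = fpsX * FPS (fun n => c ^+ n.+1 / n.+1`!%:R).
Proof.
apply: fpsP => -[|n]; rewrite fcoefXM fcoefB fcoef1 fcoef_exp.
  by rewrite divr1 subrr.
by rewrite subr0.
Qed.

Lemma fps_expB1_I c : c != 0 -> injective ( *%R (fps_exp c - 1)).
Proof.
move=> c0 f g; rewrite fps_expB1 -!mulrA => /fpsXI/fps_unitI; apply=> /=.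
by rewrite expr1 divr1.
Qed.

(** The Bernoulli generating function at c z, kept multiplied out because [fps_exp c - 1] has zero
    constant term, hence no inverse. *)
Lemma bernoulli_scaled_gen c t :
  fps_scale c (FPS (fun n => bernoulli n t / n`!%:R)) * (fps_exp c - 1) =
  fpsC c * (fpsX * fps_exp (c * t)).
Proof.
have expE : fps_exp c - 1 = fps_scale c (fps_exp 1 - 1).
  apply: fpsP => -[|n]; rewrite fcoef_scale !fcoefB !fcoef1 !fcoef_exp.
    by rewrite !expr0 !divr1 subrr mulr0.
  by rewrite !subr0 expr1n mul1r.
rewrite expE -fps_scaleM; apply: fpsP => n.
have -> : FPS (fun n => bernoulli n t / n`!%:R) * (fps_exp 1 - 1) =
          fpsX * fps_exp t.
  apply: fpsP => m; rewrite fcoefXM -[RHS]bernoulli_gen.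
  apply: eq_bigr => i _; congr (_ * _); rewrite fcoefB fcoef1 fcoef_exp expr1n.
  by case: (m - i)%N => [|p]; rewrite ?divr1 ?mul0r ?subrr ?subr0.
rewrite fcoef_scale fcoefCM !fcoefXM; case: n => [|n]; first by rewrite !mulr0.
by rewrite !fcoef_exp exprMn exprS !mulrA.
Qed.

Variables (k : nat) (rho : F).
Hypotheses (k_gt0 : (0 < k)%N) (rho_k : rho ^+ k = 1).

Let k_neq0 : k%:R != 0 :> F. Proof. by rewrite pnatr_eq0 -lt0n. Qed.

Definition factor_series j : fpseries F := FPS (fun a => \sum_(0 <= i < k)
  rho ^+ (j * i) * (j%:R ^+ a * (k%:R ^ (a%:Z - 1) / a`!%:R) *
                    bernoulli a (i%:R / k%:R))).

(** As j^a k^(a-1) = k^(-1) (jk)^a, the powers in the coefficients amount to dilating z by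
    [j * k]. *)
Lemma factor_seriesE j : factor_series j = fpsC k%:R^-1 *
  \sum_(0 <= i < k) fpsC (rho ^+ (j * i)) *
    fps_scale (j * k)%:R (FPS (fun n => bernoulli n (i%:R / k%:R) / n`!%:R)).
Proof.
apply: fpsP => a; rewrite fcoefCM fcoef_sum mulr_sumr; apply: eq_bigr => i _.
rewrite fcoefCM fcoef_scale /= natrM exprMn expfzDr // -exprnP exprN1.
by ring.
Qed.

(* Multiplying by 1 + w + ... + w^(k-1), with w = (rho e^z)^j, turns
   w - 1 into w^k - 1 = e^(jkz) - 1, where the Bernoulli generating function
   applies. *)
Lemma factor_seriesP j : (0 < j)%N ->
  factor_series j * (1 - (fpsC rho * fps_exp 1) ^+ j) = - (fpsC j%:R * fpsX).
Proof.
move=> j_gt0; pose w := (fpsC rho * fps_exp 1) ^+ j.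
have w_k : w ^+ k = fps_exp (j * k)%:R.
  rewrite /w -exprM exprMn -rmorphXn /= mulnC exprM rho_k expr1n rmorph1 mul1r.
  by rewrite -fps_expMn mulnC.
have w_i i : w ^+ i = fpsC (rho ^+ (j * i)) * fps_exp (j * i)%:R.
  by rewrite /w -exprM exprMn -rmorphXn -fps_expMn.
have jk_neq0 : (j * k)%:R != 0 :> F by rewrite pnatr_eq0 -lt0n muln_gt0 j_gt0.
apply: (fps_expB1_I jk_neq0); rewrite -w_k -/w.
have sumE : factor_series j * (w ^+ k - 1) =
            fpsC j%:R * fpsX * \sum_(i < k) w ^+ i.
  rewrite factor_seriesE w_k -mulrA mulr_suml big_mkord !mulr_sumr.
  apply: eq_bigr => i _; rewrite -mulrA bernoulli_scaled_gen w_i.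
  have -> : (j * k)%:R * (i%:R / k%:R) = (j * i)%:R :> F.
    by rewrite !natrM; field.
  have -> : fpsC j%:R = fpsC (k%:R^-1) * fpsC (j * k)%:R :> fpseries F.
    by rewrite -rmorphM /= natrM mulrCA mulVf // mulr1.
  by ring.
rewrite mulrA [_ * factor_series j]mulrC sumE subrX1.
by ring.
Qed.

Variable l : nat.

(** Discrete Fourier transform in the residue r: it turns the cyclic convolution of the recursion
    into a product. *)
Definition weighted_Ecoef N m : F :=
  \sum_(0 <= r < k) rho ^+ r * Ecoef F k l N m r%:Z.

(** This lets the sum over a in the recursion, cut at m - l, be completed to a Cauchy product. For N
    = 0, fewer than l points cannot form l blocks; for N > 0, the range of a is empty. *)
Fact weighted_Ecoef_small N m : (m < l)%N -> weighted_Ecoef N m = 0.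
Proof.
move=> lt_ml; apply: big1 => r _; case: N => [|N] /=.
  rewrite (_ : stirling2 m l = 0%N) ?mulr0 ?mul0r ?mulr0 //.
  apply/eqP; rewrite cards_eq0; apply/eqP/setP=> P; rewrite !inE.
  apply/negP=> /andP[partP /eqP cardP].
  have := card_partition partP; rewrite cardsT card_ord => mE.
  have : (\sum_(A in P) 1 <= \sum_(A in P) #|A|)%N.
    apply: leq_sum => A PA; rewrite card_gt0.
    by apply: contraTneq PA => ->; have /and3P[] := partP.
  by rewrite -mE sum1_card cardP leqNgt lt_ml.
by rewrite (eqnP (lt_ml : (m.+1 <= l)%N)) big_geq ?mulr0.
Qed.

(** Adding [s] permutes the residues modulo [k], and [rho ^+ r] depends only on the residue of r
    because rho^k = 1. *)
Fact weighted_Ecoef_shift N m (s : nat) :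
  \sum_(0 <= r < k) rho ^+ r * Ecoef F k l N m ((r%:Z - s%:Z) %% k%:Z)%Z =
  rho ^+ s * weighted_Ecoef N m.
Proof.
pose sh (r : 'I_k) : 'I_k := Ordinal (ltn_pmod (r + s) k_gt0).
have sh_inj : injective sh.
  move=> r1 r2 /(congr1 val) /= /eqP; rewrite eqn_modDr !modn_small //.
  by move/eqP/val_inj.
rewrite /weighted_Ecoef !big_mkord mulr_sumr (reindex_inj sh_inj).
apply: eq_bigr => r _ /=; rewrite mulrA.
have -> : rho ^+ ((r + s) %% k) = rho ^+ s * rho ^+ r.
  by rewrite -exprD (addnC s) [in RHS](divn_eq (r + s) k) exprD mulnC exprM rho_k
             expr1n mul1r.
congr (_ * Ecoef _ _ _ _ _ _).
rewrite -modz_nat modzDml PoszD addrK modz_small //.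
by rewrite ltz_nat ltn_ord.
Qed.

Hypothesis l_gt0 : (0 < l)%N.

(** The index m starts at 1 in the recursion, so it is lowered by one; E(N, N) then sits at z^(N-1),
    where the residue is read once z^N is cleared. *)
Definition Ecoef_series N : fpseries F := FPS (fun m => weighted_Ecoef N m.+1).

Lemma Ecoef_seriesS N :
  Ecoef_series N.+1 = factor_series N.+1 * Ecoef_series N.
Proof.
apply: fpsP => m; rewrite fcoefM /=.
transitivity (\sum_(0 <= a < m.+1)
    factor_series N.+1 a * weighted_Ecoef N (m.+1 - a)); last first.
  by rewrite big_mkord; apply: eq_bigr => a _; rewrite subSn // -ltnS.
(* The terms from [m.+2 - l] on vanish by [weighted_Ecoef_small]; [l_gt0] keeps this bound within
   the range. *)
rewrite (@big_cat_nat _ _ _ (m.+2 - l)) //=; last by lia.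
rewrite [X in _ + X]big_nat_cond [X in _ + X]big1 ?addr0; last first.
  move=> a /andP[/andP[le_a lt_a] _]; rewrite weighted_Ecoef_small ?mulr0 //.
  by lia.
rewrite /weighted_Ecoef /=; under eq_bigr => r _ do rewrite mulr_sumr.
rewrite exchange_big /=; apply: eq_bigr => a _.
under eq_bigr => r _ do rewrite mulrA mulr_sumr.
rewrite exchange_big /= mulr_suml; apply: eq_bigr => j _.
transitivity (((N.+1)%:R ^+ a * (k%:R ^ (a%:Z - 1) / a`!%:R) *
    bernoulli a (j%:R / k%:R)) * \sum_(0 <= r < k)
    rho ^+ r * Ecoef F k l N (m.+1 - a) ((r%:Z - (N.+1 * j)%N%:Z) %% k%:Z)%Z).
  by rewrite mulr_sumr; apply: eq_bigr => r _; ring.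
by rewrite weighted_Ecoef_shift /weighted_Ecoef; ring.
Qed.

Lemma Ecoef_series0 :
  fpsC (l.-1)`!%:R * Ecoef_series 0 = fps_exp 1 * (fps_exp 1 - 1) ^+ l.-1.
Proof.
rewrite -stirling2_succ_egf; apply: fpsP => m; rewrite fcoefCM /=.
rewrite /weighted_Ecoef big_ltn // big_nat_cond big1 => [|r].
  by rewrite /= addr0 !mul1r prednK // natrM; ring.
by rewrite andbT => /andP[r_gt0 _] /=; rewrite eqz_nat gtn_eqF // !mul0r mulr0.
Qed.

Lemma Ecoef_seriesE N :
  fpsC (l.-1)`!%:R * Ecoef_series N =
  (\prod_(1 <= j < N.+1) factor_series j) *
  (fps_exp 1 * (fps_exp 1 - 1) ^+ l.-1).
Proof.
elim: N => [|N IHN]; first by rewrite big_geq // mul1r Ecoef_series0.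
by rewrite big_nat_recr //= Ecoef_seriesS mulrCA IHN; ring.
Qed.

End BernoulliSeries.

(** * Residues as coefficients of power series *)

Section Residues.
Variable F : numFieldType.
Implicit Types (rho : F) (f Y : fpseries F).

(** [u] is (e^z - 1) / z; its inverse Y expresses (e^z - 1)^(-t) as z^(-t) Y^t, so that residues
    become coefficients of ordinary series. *)
Let u : fpseries F := FPS (fun n => 1 ^+ n.+1 / n.+1`!%:R).

(* The residue of e^z / (e^z - 1)^(t+1), i.e. that of the differential form
   dx / x^(t+1) with x = e^z - 1. *)
Lemma residue_exp Y t : u * Y = 1 -> (fps_exp 1 * Y ^+ t.+1) t = (t == 0%N)%:R.
Proof.
move=> uY.
have u0 : u 0%N = 1 by rewrite /= divr1.
have Y0 : Y 0%N = 1.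
  by move: (fcoefM0 u Y); rewrite uY u0 mul1r fcoef1.
case: t => [|t]; first by rewrite expr1 fcoefM0 Y0 fcoef_exp mulr1 divr1.
have XD : fps_deriv fpsX = 1 :> fpseries F.
  apply: fpsP => n; rewrite fcoef_deriv fcoef1 /=.
  by case: n => [|n] //=; rewrite mul0rn.
have expE : fps_exp 1 = u + fpsX * fps_deriv u :> fpseries F.
  by rewrite -fps_deriv_exp1 fps_expB1 fps_derivM XD mul1r.
have DY : fps_deriv u * Y + u * fps_deriv Y = 0.
  by rewrite -fps_derivM uY fps_deriv1.
have DuY : fps_deriv u * Y ^+ 2 = - fps_deriv Y.
  apply/eqP; rewrite -addr_eq0 -[X in _ + X]mul1r -uY; apply/eqP.
  by rewrite -[RHS](mulr0 Y) -DY; ring.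
have t_neq0 : t.+1%:R != 0 :> F by rewrite pnatr_eq0.
apply: (mulfI t_neq0); rewrite mulr0 -fcoefCM.
(* By e^z = u + z u' and u' Y^2 = - Y'. The two terms on the right have the same coefficient at
   z^(t+1): an exact form has no residue. *)
have -> : fpsC t.+1%:R * (fps_exp 1 * Y ^+ t.+2) =
          fpsC t.+1%:R * Y ^+ t.+1 - fpsX * fps_deriv (Y ^+ t.+1).
  rewrite fps_derivX expE -[(_ * _) *+ _]mulr_natl rmorph_nat.
  transitivity (t.+1%:R * ((u * Y) * Y ^+ t.+1 +
                 fpsX * Y ^+ t * (fps_deriv u * Y ^+ 2))).
    by rewrite !exprS; ring.
  by rewrite uY DuY; ring.
by rewrite fcoefB fcoefCM fcoefXM fcoef_deriv mulr_natl subrr.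
Qed.

(** After division by z^N this is the residue of e^z (e^z - 1)^(l-1-i), whose exponent is -1 exactly
    when i = l. *)
Lemma residue_expX Y N l i : u * Y = 1 -> (0 < l)%N -> (0 < i <= N)%N ->
  (fpsX ^+ (N - i) * Y ^+ i * (fps_exp 1 * (fps_exp 1 - 1) ^+ l.-1)) N.-1 =
  (i == l)%:R.
Proof.
move=> uY l_gt0 /andP[i_gt0 le_iN]; rewrite fps_expB1 -/u exprMn.
have [lt_il|le_li] := ltnP i l.
  (* There is no pole in this case: the power of [fpsX] is at least [N]. *)
  rewrite (_ : _ * _ = fpsX ^+ (N - i + l.-1) *
                        (Y ^+ i * fps_exp 1 * u ^+ l.-1)); last first.
    by rewrite exprD; ring.
  rewrite fcoefXnM ifF; last by lia.
  by rewrite ltn_eqF.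
rewrite (_ : _ * _ = fpsX ^+ (N - i + l.-1) * (fps_exp 1 * Y ^+ (i - l).+1)).
  rewrite fcoefXnM ifT; last by lia.
  rewrite (_ : N.-1 - _ = i - l)%N; last by lia.
  by rewrite residue_exp // subn_eq0 eqn_leq le_li andbT.
rewrite (_ : Y ^+ i = Y ^+ (i - l).+1 * Y ^+ l.-1); last first.
  by rewrite -exprD; congr (_ ^+ _); lia.
transitivity (fpsX ^+ (N - i) * fpsX ^+ l.-1 * (fps_exp 1 * Y ^+ (i - l).+1) *
              (u * Y) ^+ l.-1).
  by rewrite exprMn; ring.
by rewrite uY expr1n mulr1 -exprD.
Qed.

(** The last hypothesis is 1/p = sum_i A_i x^(-i) + s/r with denominators cleared; [x] is q - rho at
    q = rho e^z. Multiplied by c z^N, it splits [G] into polar terms, among which [residue_expX]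
    selects i = l, and a multiple of z^N, which does not reach the coefficient of z^(N-1). *)
Lemma polar_coef_residue (A : nat -> F) (rho c : F) (n N l : nat)
    (p G r s : fpseries F) (x := fpsC rho * (fps_exp 1 - 1)) :
    rho != 0 -> r 0%N != 0 -> (n <= N)%N -> (0 < l <= n)%N ->
    G * p = fpsC c * fpsX ^+ N ->
    r * (x ^+ n - p * \sum_(1 <= i < n.+1) fpsC (A i) * x ^+ (n - i)) =
      s * p * x ^+ n ->
  (G * (fps_exp 1 * (fps_exp 1 - 1) ^+ l.-1)) N.-1 = c * rho ^- l * A l.
Proof.
move=> rho0 r0 le_nN /andP[l_gt0 le_ln] Gp polar.
have [Y uY] : exists Y, u * Y = 1 by apply: fps_inv; rewrite /= divr1 oner_eq0.
have [r' rr'] := fps_inv r0.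
pose y := fpsC rho^-1 * Y.
have xy : x * y = fpsX.
  rewrite /x /y fps_expB1 -/u.
  transitivity (fpsC rho * fpsC rho^-1 * fpsX * (u * Y)); first by ring.
  by rewrite uY -rmorphM /= mulfV // rmorph1 mul1r mulr1.
clearbody x.
have GE : G = \sum_(1 <= i < n.+1) fpsC (c * A i) * (fpsX ^+ (N - i) * y ^+ i) +
              fpsX ^+ N * (r' * s * fpsC c).
  (* Multiplying by z^n = x^n y^n brings back the nonnegative powers x^(n-i) of [polar]. *)
  apply: (@fpsXnI _ n); rewrite mulrDr -[in LHS]xy exprMn.
  have -> : x ^+ n = p * (\sum_(1 <= i < n.+1) fpsC (A i) * x ^+ (n - i)) +
                     r' * s * p * x ^+ n.
    have polar' := congr1 ( *%R r') polar.
    rewrite mulrA [r' * r]mulrC rr' mul1r in polar'.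
    by move/eqP: polar'; rewrite subr_eq addrC !mulrA => /eqP.
  transitivity ((G * p) *
    (y ^+ n * \sum_(1 <= i < n.+1) fpsC (A i) * x ^+ (n - i)) +
     (G * p) * (r' * s * (x * y) ^+ n)).
    by rewrite [(x * y) ^+ _]exprMn; ring.
  rewrite Gp xy; congr (_ + _); last by ring.
  rewrite !mulr_sumr; apply: eq_big_nat => i /andP[i_gt0]; rewrite ltnS => le_in.
  rewrite -{1}(subnK le_in) exprD rmorphM /=.
  transitivity (fpsC c * fpsC (A i) * (fpsX ^+ N * (x * y) ^+ (n - i)) * y ^+ i).
    by rewrite [(x * y) ^+ _]exprMn; ring.
  rewrite xy -exprD (_ : (N + (n - i) = n + (N - i))%N); last by lia.
  by rewrite exprD; ring.
rewrite GE mulrDl fcoefD -mulrA [X in _ + X]fcoefXnM ifF; last by lia.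
rewrite addr0 mulr_suml fcoef_sum.
rewrite (eq_big_nat _ _
  (F2 := fun i => c * rho ^- i * A i * (i == l)%:R)); last first.
  move=> i; rewrite ltnS => /andP[i_gt0 le_in].
  rewrite /y exprMn -(rmorphXn (@fpsC F)).
  rewrite -(@residue_expX Y N l i) ?i_gt0 ?(leq_trans le_in) // -exprVn.
  have CE : fpsC (c * rho^-1 ^+ i * A i) = fpsC (c * A i) * fpsC (rho^-1 ^+ i).
    by rewrite -rmorphM /= mulrAC.
  rewrite -fcoefCM CE; apply: (congr1 (fun f : fpseries F => f N.-1)).
  by ring.
rewrite (bigD1_seq l) ?iota_uniq //=; last by rewrite mem_index_iota l_gt0 ltnS.
rewrite eqxx mulr1 big1 ?addr0 // => i /negPf->.
by rewrite mulr0.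
Qed.

End Residues.

(** * Rational functions regular at [rho], and clearing of denominators *)

Section RegularPart.
Variables (F : numFieldType) (P : {poly F}) (rho : F).

Lemma poly_horner0 (p : {poly F}) : (forall q, p.[q] = 0) -> p = 0.
Proof.
move=> p0; apply: contraTeq isT => p_neq0.
(* In characteristic zero these are [size p] distinct roots, one more than a nonzero [p] admits. *)
pose rs : seq F := [seq i%:R | i <- iota 0 (size p)].
have : (size rs < size p)%N.
  apply: max_poly_roots => //; first by apply/allP => q _; apply/rootP.
  by rewrite map_inj_uniq ?iota_uniq // => i j /eqP; rewrite eqr_nat => /eqP.
by rewrite size_map size_iota ltnn.
Qed.

(** The denominator may vanish at roots of [P] other than [rho]: this accommodates the remaining
    poles of the decomposition. *)
Definition regular_at (f : F -> F) : Prop :=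
  exists S R : {poly F}, R.[rho] != 0 /\
    forall q, P.[q] != 0 -> R.[q] != 0 /\ f q = S.[q] / R.[q].

Lemma regular_at0 : regular_at (fun=> 0).
Proof.
exists 0, 1; rewrite hornerE oner_eq0; split=> // q _.
by rewrite !hornerE oner_eq0 ?mul0r.
Qed.

Lemma regular_atD f g :
  regular_at f -> regular_at g -> regular_at (fun q => f q + g q).
Proof.
move=> [S1 [R1 [r1 fE]]] [S2 [R2 [r2 gE]]].
exists (S1 * R2 + S2 * R1), (R1 * R2); split=> [|q Pq].
  by rewrite hornerM mulf_neq0.
have [[q1 ->] [q2 ->]] := (fE q Pq, gE q Pq).
by rewrite !hornerE mulf_neq0 // addf_div.
Qed.

Lemma regular_at_sum (I : eqType) (s : seq I) (Q : pred I) (f : I -> F -> F) :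
  (forall i, i \in s -> Q i -> regular_at (f i)) ->
  regular_at (fun q => \sum_(i <- s | Q i) f i q).
Proof.
elim: s => [|i s IHs] f_reg.
  have -> : (fun q => \sum_(i <- [::] | Q i) f i q) = fun=> 0.
    by apply/funext => q; rewrite big_nil.
  exact: regular_at0.
have {}IHs : regular_at (fun q => \sum_(j <- s | Q j) f j q).
  by apply: IHs => j sj; apply: f_reg; rewrite in_cons sj orbT.
have [Qi|nQi] := boolP (Q i).
  have -> : (fun q => \sum_(j <- i :: s | Q j) f j q) =
            fun q => f i q + \sum_(j <- s | Q j) f j q.
    by apply/funext => q; rewrite big_cons Qi.
  by apply: regular_atD => //; apply: f_reg; rewrite ?mem_head.
have -> // : (fun q => \sum_(j <- i :: s | Q j) f j q) =
             fun q => \sum_(j <- s | Q j) f j q.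
by apply/funext => q; rewrite big_cons (negPf nQi).
Qed.

Lemma regular_at_pole (c z : F) e :
  root P z -> z != rho -> regular_at (fun q => c / (q - z) ^+ e).
Proof.
move=> Pz z_rho; exists c%:P, (('X - z%:P) ^+ e); split=> [|q Pq].
  by rewrite !hornerE expf_neq0 // subr_eq0 eq_sym.
rewrite !hornerE expf_neq0 // subr_eq0.
by apply: contraNneq Pq => ->.
Qed.

Lemma polar_part_poly (A : nat -> F) n f : P != 0 -> root P rho ->
    regular_at f ->
    (forall q, P.[q] != 0 ->
      P.[q]^-1 = \sum_(1 <= i < n.+1) A i / (q - rho) ^+ i + f q) ->
  exists S R : {poly F}, R.[rho] != 0 /\
    R * (('X - rho%:P) ^+ n -
         P * \sum_(1 <= i < n.+1) (A i)%:P * ('X - rho%:P) ^+ (n - i)) =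
    S * P * ('X - rho%:P) ^+ n.
Proof.
move=> P0 Prho [S [R [Rrho fE]]] decP; exists S, R; split=> //.
(* The decomposition says nothing at the roots of [P]; an extra factor [P] makes the identity
   trivial there, so it can be checked at every q. *)
apply/eqP; rewrite -subr_eq0 -(mulrI_eq0 _ (mulfI P0)); apply/eqP.
apply: poly_horner0 => q; rewrite hornerM.
have [->|Pq] := eqVneq P.[q] 0; first by rewrite mul0r.
have q_rho : q - rho != 0.
  by rewrite subr_eq0; apply: contraNneq Pq => ->.
have [Rq fq] := fE q Pq.
rewrite !hornerE horner_sum.
have -> : \sum_(1 <= i < n.+1) ((A i)%:P * ('X - rho%:P) ^+ (n - i)).[q] =
          (q - rho) ^+ n * (P.[q]^-1 - f q).
  rewrite decP // addrK mulr_sumr; apply: eq_big_nat => i /andP[_].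
  rewrite ltnS => le_in; rewrite !hornerE -[in RHS](subnK le_in) exprD /=.
  by field; rewrite ?expf_neq0.
by rewrite fq; field; rewrite Rq Pq.
Qed.

End RegularPart.

(** * The substitution q = rho e^z and the extraction of one coefficient *)

Section PolarCoefficients.
Variables (F : numFieldType) (k N : nat) (rho : F).
Hypotheses (k_gt0 : (0 < k)%N) (rho_k : rho ^+ k = 1).

Definition partition_poly : {poly F} := \prod_(1 <= j < N.+1) (1 - 'X^j).

Lemma horner_partition_poly q :
  partition_poly.[q] = \prod_(1 <= j < N.+1) (1 - q ^+ j).
Proof.
by rewrite horner_prod; apply: eq_bigr => j _; rewrite !hornerE.
Qed.

Lemma root_partition_poly j (q : F) :
  (1 <= j <= N)%N -> q ^+ j = 1 -> root partition_poly q.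
Proof.
move=> j_bounds qj; rewrite /root horner_partition_poly.
rewrite (bigD1_seq j) ?iota_uniq ?mem_index_iota ?ltnS //=.
by rewrite qj subrr mul0r.
Qed.

Lemma partition_poly_neq0 : partition_poly != 0.
Proof.
rewrite prodf_seq_neq0; apply/allP => j; rewrite mem_index_iota => /andP[j_gt0 _].
apply/implyP => _; apply/negP => /eqP /(congr1 (fun p : {poly F} => p.[0])).
by rewrite !hornerE expr0n gtn_eqF // subr0 => /eqP; rewrite oner_eq0.
Qed.

Let w : fpseries F := fpsC rho * fps_exp 1.
Let subst : {rmorphism {poly F} -> fpseries F} :=
  horner_morph (fun a => mulrC w (fpsC a)).

Fact substX : subst 'X = w. Proof. exact: horner_morphX. Qed.
Fact substC a : subst a%:P = fpsC a. Proof. exact: horner_morphC. Qed.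

(** At z = 0 the substituted q is [rho]; a denominator not vanishing at [rho] thus becomes an
    invertible series. *)
Lemma subst0 p : subst p 0%N = p.[rho].
Proof.
elim/poly_ind: p => [|p c IHp]; first by rewrite rmorph0 horner0.
rewrite rmorphD rmorphM fcoefD fcoefM0 IHp.
by rewrite substX substC !hornerE fcoefCM fcoef_exp divr1 mulr1.
Qed.

(** Each j contributes - j z by [factor_seriesP]. The product can thus serve as [G] in
    [polar_coef_residue], with c = (-1)^N N!. *)
Lemma prod_factor_series :
  (\prod_(1 <= j < N.+1) factor_series k rho j) * subst partition_poly =
  fpsC ((-1) ^+ N * N`!%:R) * fpsX ^+ N.
Proof.
rewrite rmorph_prod -big_split /=.
elim: N => [|n IHn]; first by rewrite big_geq // !mul1r rmorph1 mul1r.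
rewrite big_nat_recr //= IHn rmorphB rmorphXn rmorph1 /= substX.
rewrite factor_seriesP // factS natrM !exprS !rmorphM rmorphN1 /=.
by ring.
Qed.

(** One coefficient of z^(N-1) is computed twice: [polar_coef_residue] gives (-1)^N N! rho^(-l) A_l,
    and [Ecoef_seriesE] gives (l-1)! times [weighted_Ecoef] at (N, N). *)
Lemma polar_coef_Ecoef (A : nat -> F) (f : F -> F) n l :
    (n <= N)%N -> (0 < l <= n)%N -> root partition_poly rho ->
    regular_at partition_poly rho f ->
    (forall q, partition_poly.[q] != 0 -> partition_poly.[q]^-1 =
      \sum_(1 <= i < n.+1) A i / (q - rho) ^+ i + f q) ->
  A l = (-1) ^+ N * (l.-1)`!%:R / N`!%:R *
        \sum_(0 <= r < k) rho ^+ (r + l) * Ecoef F k l N N r%:Z.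
Proof.
move=> le_nN l_bounds root_rho f_reg decA; have /andP[l_gt0 le_ln] := l_bounds.
have [S [R [R_rho]]] := polar_part_poly partition_poly_neq0 root_rho f_reg decA.
move/(congr1 subst); rewrite !rmorphM rmorphB rmorphM rmorph_sum !rmorphXn /=.
rewrite rmorphB /= substX substC.
under eq_bigr => i _ do
  rewrite rmorphM rmorphXn rmorphB /= substX !substC.
have -> : w - fpsC rho = fpsC rho * (fps_exp 1 - 1) by rewrite mulrBr mulr1.
have rho0 : rho != 0.
  by apply: contra_eq_neq rho_k => ->; rewrite expr0n gtn_eqF // eq_sym oner_eq0.
have subst_R : subst R 0%N != 0 by rewrite subst0.
move/(polar_coef_residue rho0 subst_R le_nN l_bounds prod_factor_series).
have N_gt0 : (0 < N)%N by lia.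
rewrite -(Ecoef_seriesE k_gt0 rho_k l_gt0) fcoefCM /= prednK // => resE.
have N0 := @natr_fact_neq0 F N.
under eq_bigr => r _ do rewrite addnC exprD -mulrA.
rewrite -mulr_sumr -/(weighted_Ecoef k rho l N N).
(* Solves [resE] for [A l]; the sign is its own inverse. *)
transitivity ((-1) ^+ N * (N`!%:R)^-1 * rho ^+ l *
              ((-1) ^+ N * N`!%:R * rho ^- l * A l)); last by rewrite -resE; ring.
have sgn : (-1) ^+ N * (-1) ^+ N = 1 :> F by rewrite -expr2 sqrr_sign.
transitivity ((-1) ^+ N * (-1) ^+ N * A l); first by rewrite sgn mul1r.
by field; rewrite N0 expf_neq0.
Qed.

End PolarCoefficients.

(** * The roots of unity [zeta] *)

Section RootsOfUnity.
Variable R : realType.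

Lemma expiD (x y : R) : expi (x + y) = expi x * expi y.
Proof.
by apply/eqP; rewrite eq_complex /= cosD sinD eqxx [eqbRHS]addrC eqxx.
Qed.

Lemma expiMn (x : R) n : expi (x *+ n) = expi x ^+ n.
Proof.
elim: n => [|n IHn]; last by rewrite mulrS expiD IHn exprS.
by apply/eqP; rewrite /expi eq_complex /= cos0 sin0 !eqxx.
Qed.

Lemma expi2pi : expi (2 * pi : R) = 1.
Proof.
by apply/eqP; rewrite eq_complex /= mulr_natl cos2pi sin2pi !eqxx.
Qed.

(** The real part is cos x = 1 - 2 sin^2(x/2), and sin(x/2) > 0 because x/2 lies strictly between 0
    and pi. *)
Lemma expi_neq1 (x : R) : 0 < x < 2 * pi -> expi x != 1.
Proof.
move=> /andP[x_gt0 x_lt].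
have x2 : x = (x / 2) *+ 2 by rewrite -mulr_natr divfK ?pnatr_eq0.
have sin_x2 : 0 < sin (x / 2).
  by apply: sin_gt0_pi; rewrite divr_gt0 //= ltr_pdivrMr // mulrC.
rewrite eq_complex /= negb_and x2 cos_mulr2n; apply/orP; left.
apply: contraTneq sin_x2 => cosE; rewrite -leNgt.
have /eqP : sin (x / 2) ^+ 2 *+ 2 = 0.
  by have := cos2Dsin2 (x / 2); move: cosE; lra.
by rewrite mulrn_eq0 /= sqrf_eq0 => /eqP->.
Qed.

Lemma zetaE h k : zeta R h k = zeta R 1 k ^+ h.
Proof. by rewrite -expiMn /zeta mulr1n mulr1 -[(_ / _) *+ h]mulr_natr mulrAC. Qed.

Lemma zeta1_prim k : (0 < k)%N -> k.-primitive_root (zeta R 1 k).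
Proof.
move=> k_gt0; have kR_gt0 : 0 < k%:R :> R by rewrite ltr0n.
rewrite /primitive_root_of_unity k_gt0; apply/forallP => i; rewrite unity_rootE.
apply/eqP; rewrite -zetaE /zeta; have [->|i_k] := eqVneq i.+1 k.
  by rewrite mulfK ?(gt_eqF kR_gt0) // expi2pi eqxx.
apply/negbTE/expi_neq1; rewrite divr_gt0 ?mulr_gt0 ?ltr0n ?pi_gt0 //=.
rewrite ltr_pdivrMr // ltr_pM2l ?mulr_gt0 ?pi_gt0 ?ltr0n // ltr_nat.
by rewrite ltn_neqAle i_k ltn_ord.
Qed.

Lemma zeta_prim h k :
  (0 < k)%N -> coprime h k -> k.-primitive_root (zeta R h k).
Proof.
by move=> k_gt0 hk; rewrite zetaE prim_root_exp_coprime // zeta1_prim.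
Qed.

(** The multiplicative order recovers k, and the exponent modulo k of a primitive root then recovers
    h. This separates the poles of the decomposition. *)
Lemma zeta_inj h k h' k' : (h < k)%N -> (h' < k')%N ->
  coprime h k -> coprime h' k' ->
  zeta R h' k' = zeta R h k -> h' = h /\ k' = k.
Proof.
move=> lt_hk lt_hk' hk hk' eq_zeta.
have k_gt0 : (0 < k)%N by lia.
have k'_gt0 : (0 < k')%N by lia.
have prim := zeta_prim k_gt0 hk; have prim' := zeta_prim k'_gt0 hk'.
have eq_k : k' = k.
  apply/eqP; rewrite eqn_dvd (prim_order_dvd prim) (prim_order_dvd prim').
  by rewrite eq_zeta (prim_expr_order prim) -eq_zeta (prim_expr_order prim') eqxx.
split=> //; move: eq_zeta lt_hk'; rewrite eq_k (zetaE h) (zetaE h') => /eqP.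
rewrite (eq_prim_root_expr (zeta1_prim k_gt0)) => eq_h lt_h'.
by rewrite !modn_small // in eq_h; apply/eqP.
Qed.

End RootsOfUnity.

(** * Isolating one pole of the full decomposition *)

Theorem theorem5p1 (R : realType) (k l N h : nat)
    (C : nat -> nat -> nat -> R[i])
    (N_ge1 : (1 <= N)%N) (C_rademacher : rademacher_coefs N C)
    (k_bounds : (1 <= k <= N)%N)
    (h_lt_k : (0 <= h < k)%N) (coprime_hk : coprime h k)
    (l_bounds : (1 <= l <= N %/ k)%N) :
  C h k l =
    (-1) ^+ N * (l.-1)`!%:R / N`!%:R *
    \sum_(0 <= r < k) zeta R h k ^+ (r + l) * Ecoef R[i] k l N N r%:Z.
Proof.
have /andP[k_gt0 le_kN] := k_bounds.
have zeta_root h' k' : (1 <= k' <= N)%N -> coprime h' k' ->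
    root (partition_poly R[i] N) (zeta R h' k').
  move=> k'_bounds hk'; have /andP[k'_gt0 _] := k'_bounds.
  by apply: (root_partition_poly k'_bounds); apply/prim_expr_order/zeta_prim.
pose T k' h' q := \sum_(1 <= i < (N %/ k').+1) C h' k' i / (q - zeta R h' k') ^+ i.
(* The terms at all other poles: first those with the same denominator [k], then those with another
   denominator. *)
pose f q := \sum_(0 <= h' < k | (h' != h) && coprime h' k) T k h' q +
  \sum_(1 <= k' < N.+1 | k' != k) \sum_(0 <= h' < k' | coprime h' k') T k' h' q.
have f_regular : regular_at (partition_poly R[i] N) (zeta R h k) f.
  have T_regular k' h' : (1 <= k' <= N)%N -> (h' < k')%N -> coprime h' k' ->
      (h', k') != (h, k) ->
      regular_at (partition_poly R[i] N) (zeta R h k) (T k' h').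
    move=> k'_bounds lt_hk' hk' ne; apply: regular_at_sum => i _ _.
    apply: regular_at_pole; first exact: zeta_root.
    apply: contraNneq ne => eq_zeta; apply/eqP.
    by have [-> ->] := zeta_inj h_lt_k lt_hk' coprime_hk hk' eq_zeta.
  apply: regular_atD; apply: regular_at_sum.
    move=> h'; rewrite mem_index_iota => /andP[_ lt_h'] /andP[ne hk'].
    by apply: T_regular => //; rewrite xpair_eqE (negPf ne).
  move=> k'; rewrite mem_index_iota ltnS => k'_bounds ne.
  apply: regular_at_sum => h'; rewrite mem_index_iota => /andP[_ lt_h'] hk'.
  by apply: T_regular => //; rewrite xpair_eqE (negPf ne) andbF.
have dec q : (partition_poly R[i] N).[q] != 0 -> (partition_poly R[i] N).[q]^-1 =
    \sum_(1 <= i < (N %/ k).+1) C h k i / (q - zeta R h k) ^+ i + f q.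
  move=> Pq; have q_pole j : (1 <= j <= N)%N -> q ^+ j != 1.
    by move=> j_bounds; apply: contraNneq Pq => /(root_partition_poly j_bounds).
  rewrite horner_partition_poly -prodfV (C_rademacher q q_pole).
  rewrite (bigD1_seq k) ?iota_uniq ?mem_index_iota ?ltnS //= /f addrA.
  congr (_ + _); rewrite big_mkcond (bigD1_seq h) ?iota_uniq ?mem_index_iota //=.
  by rewrite coprime_hk -big_mkcondr.
(* The bound n on the order of the pole is [N %/ k], which is at most [N]. *)
apply: (polar_coef_Ecoef (A := C h k) k_gt0 _ (leq_div N k) l_bounds _ f_regular dec).
  exact/prim_expr_order/zeta_prim.
exact: zeta_root.
Qed.
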